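(* Let $(T_n)_{n\ge 0}$ be the Tribonacci sequence. The Diophantine equation $$(T_{n}+1)(T_{n+1}+1)\cdots (T_{n+\ell-1}+1)=d\left(\frac{10^{m}-1}{9}\right)$$ has no solution in positive integers $n,\ell,m,d$ with $1\leq d\leq 9$ and $m\geq 2$.
   Context: The Tribonacci sequence is defined by $T_0=0$, $T_1=T_2=1$ and $T_{n+3}=T_{n+2}+T_{n+1}+T_n$ for all $n\ge 0$. The right-hand side $d(10^m-1)/9$ is the repdigit consisting of $m$ copies of the digit $d$. *)

(* Defs.v *)
From mathcomp Require Import all_boot.

Set Implicit Arguments.
Unset Strict Implicit.
Unset Printing Implicit Defensive.

Fixpoint tribonacci (n : nat) : nat :=
  match n with
  | 0 => 0
  | 1 => 1
  | 2 => 1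
  | ((k.+1 as k1).+1 as k2).+1 => tribonacci k2 + tribonacci k1 + tribonacci k
  end.

(* Main.v *)
(** With P the product, the equation reads x := 9 P + d = d * 10^m.

    Among eight consecutive factors four are even, so 16 divides P once l >= 8,
    whereas a repdigit has 2-adic valuation at most 3.  For l <= 7 and m >= 4,
    x vanishes modulo 16 and 25, and if 10 has order Q modulo a prime p, then
    x^Q = d^Q modulo p; these conditions do not involve m and are periodic in n.
    Modulo 16, 25, 44641 and 4093 they leave no residue class for n modulo
    491040.  For m <= 3 growth bounds n by 13. *)

From Stdlib Require Import ZArith Nnat Zpow_facts.
From mathcomp Require Import all_boot zify.
Require Import Defs.

Set Implicit Arguments.
Unset Strict Implicit.
Unset Printing Implicit Defensive.

(** * Products of shifted Tribonacci numbers, and repunits *)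

Lemma tribonacciS n :
  tribonacci n.+3 = tribonacci n.+2 + tribonacci n.+1 + tribonacci n.
Proof. by []. Qed.

Lemma tribonacci_homo : {homo tribonacci : m n / m <= n}.
Proof.
apply: homo_leq => //; first exact: leq_trans.
by case=> [|[|n]] //; rewrite tribonacciS -addnA leq_addr.
Qed.

Definition succ_prod n l := \prod_(0 <= i < l) (tribonacci (n + i) + 1).

Lemma succ_prod0 n : succ_prod n 0 = 1.
Proof. exact: big_geq. Qed.

Lemma succ_prodS n l :
  succ_prod n l.+1 = (tribonacci n + 1) * succ_prod n.+1 l.
Proof.
rewrite /succ_prod big_nat_recl // addn0; congr (_ * _).
by apply: eq_bigr => i _; rewrite addSnnS.
Qed.

Lemma succ_prodD n l k :
  succ_prod n (l + k) = succ_prod n l * succ_prod (n + l) k.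
Proof.
elim: l n => [|l IHl] n; first by rewrite succ_prod0 mul1n addn0.
by rewrite addSn !succ_prodS IHl -mulnA addSnnS.
Qed.

Lemma succ_prod_gt0 n l : 0 < succ_prod n l.
Proof.
elim: l n => [|l IHl] n; first by rewrite succ_prod0.
by rewrite succ_prodS muln_gt0 addn1 IHl.
Qed.

Definition repunit m := (10 ^ m - 1) %/ 9.

Lemma repunitE m : 9 * repunit m + 1 = 10 ^ m.
Proof.
have d9 : 9 %| 10 ^ m - 1 by rewrite -eqn_mod_dvd ?expn_gt0 // -modnXm exp1n.
by rewrite /repunit mulnC divnK // subnK // expn_gt0.
Qed.

(** For $m > 0$ the power $10^m = 9R + 1$ is even, so the repunit $R$ is odd. *)
Lemma coprime_repunit_16 m : 0 < m -> coprime 16 (repunit m).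
Proof.
move=> m0; rewrite (@coprimeXl 4 2) // coprime2n.
have /(congr1 odd) := repunitE m.
by rewrite oddD oddM oddX /= eqn0Ngt m0; case: odd.
Qed.

Local Open Scope Z_scope.

(** * Tribonacci residues by index doubling, and their periods *)

Definition trib n : Z := Z.of_nat (tribonacci n).

Lemma tribS n : trib n.+3 = trib n.+2 + trib n.+1 + trib n.
Proof. rewrite /trib tribonacciS; lia. Qed.

(** The coefficients are $T_{n-1}$, $T_n - T_{n-1}$ and $T_{n-2}$, rewritten through $T_n, T_{n+1},
    T_{n+2}$ so that the formula also covers small $n$ and needs only one state. *)
Lemma trib_add n m :
  trib (m + n) = (trib n.+2 - trib n.+1 - trib n) * trib m.+2
    + (2 * trib n + trib n.+1 - trib n.+2) * trib m.+1
    + (2 * trib n.+1 - trib n.+2) * trib m.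
Proof.
elim: n m => [|n IHn] m.
  have [-> -> ->] : [/\ trib 0 = 0, trib 1 = 1 & trib 2 = 1] by [].
  by rewrite addn0; ring.
rewrite addnS -addSn IHn !tribS; ring.
Qed.

(* A state [(a, b, c)] stands for three consecutive terms
   [(trib n, trib n.+1, trib n.+2)]. *)
Definition state : Type := Z * Z * Z.

Definition reduce M (s : state) : state :=
  let: (a, b, c) := s in (a mod M, b mod M, c mod M).

Definition shift (s : state) : state :=
  let: (a, b, c) := s in (b, c, a + b + c).

(* [trib_add] at [m = n], [n.+1], [n.+2]. *)
Definition double (s : state) : state :=
  let: (a, b, c) := s in
  let f u v w := (c - b - a) * w + (2 * a + b - c) * v + (2 * b - c) * u in
  (f a b c, f b c (a + b + c), f c (a + b + c) (a + 2 * b + 2 * c)).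

(** Doubling along the bits of the index with a reduction at each bit, so that large indices such as
    491040 stay cheap to evaluate. *)
Fixpoint pos_state M p : state :=
  reduce M match p with
  | xH => (1, 1, 2)
  | xO q => double (pos_state M q)
  | xI q => shift (double (pos_state M q))
  end.

Definition N_state M i : state :=
  if i is Npos p then pos_state M p else (0, 1, 1).

Definition represents M (s : state) n :=
  let: (a, b, c) := s in
  [/\ eqm M a (trib n), eqm M b (trib n.+1) & eqm M c (trib n.+2)].

Ltac solve_eqm := cbv beta zeta;
  repeat first [assumption | reflexivity | apply: Zplus_eqm | apply: Zopp_eqm
               | apply: Zmult_eqm].

Lemma represents_reduce M s n : represents M s n -> represents M (reduce M s) n.
Proof. by case: s => [[a b] c] [*]; split; rewrite /eqm Zmod_mod. Qed.

Lemma represents_shift M s n : represents M s n -> represents M (shift s) n.+1.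
Proof.
case: s => [[a b] c] [Ha Hb Hc]; split=> //.
have -> : trib n.+3 = trib n + trib n.+1 + trib n.+2 by rewrite tribS; ring.
by do 2!apply: Zplus_eqm => //.
Qed.

Lemma represents_double M s n :
  represents M s n -> represents M (double s) (n + n)%N.
Proof.
case: s => [[a b] c] [Ha Hb Hc].
have E3 : trib n.+3 = trib n + trib n.+1 + trib n.+2 by rewrite tribS; ring.
have E4 : trib n.+4 = trib n + 2 * trib n.+1 + 2 * trib n.+2.
  by rewrite 2!tribS; ring.
split; rewrite -?addSn -?addSn trib_add ?E4 ?E3; solve_eqm.
Qed.

Lemma pos_stateP M p : represents M (pos_state M p) (Pos.to_nat p).
Proof.
elim: p => [p IHp|p IHp|]; apply: represents_reduce.
- have -> : Pos.to_nat p~1 = (Pos.to_nat p + Pos.to_nat p).+1 by lia.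
  exact/represents_shift/represents_double.
- have -> : Pos.to_nat p~0 = (Pos.to_nat p + Pos.to_nat p)%N by lia.
  exact: represents_double.
- by split.
Qed.

Lemma N_stateP M i : represents M (N_state M i) (N.to_nat i).
Proof. by case: i => [|p]; [split | apply: pos_stateP]. Qed.

Fixpoint state_prod (s : state) l : Z :=
  if l is l'.+1 then (s.1.1 + 1) * state_prod (shift s) l' else 1.

Lemma state_prodP M s n l :
  represents M s n -> eqm M (state_prod s l) (Z.of_nat (succ_prod n l)).
Proof.
elim: l s n => [|l IHl] s n Hs; first by rewrite succ_prod0.
rewrite succ_prodS Nat2Z.inj_mul Nat2Z.inj_add /=.
apply: Zmult_eqm (IHl _ _ (represents_shift Hs)).
by case: s Hs => [[a b] c] [Ha _ _]; apply: Zplus_eqm.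
Qed.

Definition is_period M L :=
  let: (a, b, c) := N_state M L in [&& a =? 0, b =? 1 & c =? 1].

Lemma trib_periodic M L n : is_period M L ->
  eqm M (trib (n + N.to_nat L)) (trib n).
Proof.
have := N_stateP M L; rewrite /is_period; case: (N_state M L) => [[a b] c].
case=> e0 e1 e2 /and3P[/Z.eqb_eq a0 /Z.eqb_eq b1 /Z.eqb_eq c1].
rewrite {}a0 {}b1 {}c1 in e0 e1 e2.
(* The addition formula with the residues $0, 1, 1$ in place of the terms at [L], so that both sides
   match term by term. *)
have -> : trib n = (1 - 1 - 0) * trib n.+2 + (2 * 0 + 1 - 1) * trib n.+1
    + (2 * 1 - 1) * trib n by ring.
rewrite trib_add; symmetry; solve_eqm.
Qed.

Lemma represents_mod M L s n : is_period M L ->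
  represents M s (n %% N.to_nat L)%N -> represents M s n.
Proof.
move=> per; rewrite [in X in _ -> X](divn_eq n (N.to_nat L)).
move: (n %% _)%N (n %/ _)%N => r; elim=> [|q IHq] // Hs.
have {IHq Hs} := IHq Hs; case: s => [[a b] c] [e0 e1 e2].
rewrite mulSn -addnA [(N.to_nat L + _)%N]addnC.
by split; [apply: etrans e0 _ | apply: etrans e1 _ | apply: etrans e2 _];
  symmetry; rewrite -?addSn -?addSn; exact: trib_periodic.
Qed.

(** * Sieving the index by conditions free of the exponent *)

(* A condition [(M, Q)] records that [10 ^ (Q * m)] modulo [M] is the same for
   all [m >= 4]; it turns [x = d * 10 ^ m] into a congruence free of [m]. *)
Definition pow10_stable M Q :=
  [&& 1 <? M, 0 <=? Q & Zpow_mod 10 (5 * Q) M =? Zpow_mod 10 (4 * Q) M].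

(** The single check $10^{5Q} \equiv 10^{4Q}$ propagates on multiplying by $10^Q$. It covers both
    divisors of $10^4$, where the powers vanish, and primes modulo which the order of 10 divides
    $Q$. *)
Lemma pow10_stableP M Q m : pow10_stable M Q -> (4 <= m)%N ->
  eqm M ((10 ^ Z.of_nat m) ^ Q) ((10 ^ 4) ^ Q).
Proof.
case/and3P=> /Z.ltb_lt M1 /Z.leb_le Q0 /Z.eqb_eq.
rewrite !Zpow_mod_correct -/(eqm M _ _); try lia; move=> E.
rewrite -!Z.pow_mul_r; try lia.
elim: m => [|m IHm] //; rewrite leq_eqVlt => /orP[/eqP <- //|lt4m].
have -> : Z.of_nat m.+1 * Q = Z.of_nat m * Q + Q by lia.
rewrite Z.pow_add_r; try lia.
apply: etrans E.
have -> : 5 * Q = 4 * Q + Q by lia.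
rewrite Z.pow_add_r; try lia.
by apply: Zmult_eqm; first exact: IHm.
Qed.

(** The exponent 4 stands for every $m \ge 4$, since their $Q$-th powers agree modulo [M]. *)
Definition residue_test l d M Q i :=
  Zpow_mod (9 * state_prod (N_state M i) l + d) Q M
    =? Zpow_mod (10 ^ 4 * d) Q M.

Lemma eqm_pow M a b Q : 0 <= Q -> eqm M a b -> eqm M (a ^ Q) (b ^ Q).
Proof.
move=> Q0 ab; rewrite -(Z2Nat.id Q) //.
elim: (Z.to_nat Q) => [|k IHk] //.
by rewrite Nat2Z.inj_succ !Z.pow_succ_r; try lia; apply: Zmult_eqm.
Qed.

Lemma N_to_nat_mod n L :
  N.to_nat (N.modulo (N.of_nat n) L) = (n %% N.to_nat L)%N.
Proof.
have [->|L0] := N.eq_dec L 0%num; first by rewrite modn0 N.mod_0_r Nat2N.id.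
have E := N.div_mod (N.of_nat n) L L0.
have lt := N.mod_lt (N.of_nat n) L L0.
set q := N.div _ _ in E; set r := N.modulo _ _ in E lt *.
have -> : n = (N.to_nat q * N.to_nat L + N.to_nat r)%N by lia.
by rewrite modnMDl modn_small //; lia.
Qed.

Lemma succ_prod_mod M L n l : is_period M L ->
  eqm M (state_prod (N_state M (N.modulo (N.of_nat n) L)) l)
    (Z.of_nat (succ_prod n l)).
Proof.
move=> per; apply/state_prodP/(represents_mod per).
rewrite -N_to_nat_mod; exact: N_stateP.
Qed.

Lemma residue_testP n l d m M Q L :
  pow10_stable M Q -> is_period M L -> (4 <= m)%N ->
  9 * Z.of_nat (succ_prod n l) + d = d * 10 ^ Z.of_nat m ->
  residue_test l d M Q (N.modulo (N.of_nat n) L).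
Proof.
move=> stab per m4 E; have [/Z.ltb_lt M1 /Z.leb_le Q0 _] := and3P stab.
apply/Z.eqb_eq; rewrite !Zpow_mod_correct; try lia; rewrite -/(eqm M _ _).
have Ex : eqm M (9 * state_prod (N_state M (N.modulo (N.of_nat n) L)) l + d)
              (d * 10 ^ Z.of_nat m).
  rewrite -E; apply: Zplus_eqm => //; apply: Zmult_eqm => //.
  exact: succ_prod_mod.
apply: etrans (eqm_pow Q0 Ex) _.
rewrite Z.mul_comm Z.pow_mul_l [(10 ^ 4 * d) ^ Q]Z.pow_mul_l.
apply: Zmult_eqm => //; exact: pow10_stableP.
Qed.

Definition lifts (L : N) a (s : seq N) : seq N :=
  [seq N.add i (N.mul L (N.of_nat j)) | j <- iota 0 a, i <- s].

(** The residue modulo $La$ is $r + Lj$ with $r = n \bmod L$ and $j = \lfloor n/L \rfloor \bmod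
    a$. *)
Lemma mem_lifts L a s (n : N) : (0 < a)%N -> N.modulo n L \in s ->
  N.modulo n (N.mul L (N.of_nat a)) \in lifts L a s.
Proof.
move=> a0 ns; rewrite N.Div0.mod_mul_r.
apply/allpairsP.
exists (N.to_nat (N.modulo (N.div n L) (N.of_nat a)), N.modulo n L).
split=> //=; last by rewrite N2Nat.id.
have /(N.mod_lt (N.div n L)) : N.of_nat a <> 0%num by lia.
by rewrite mem_iota; move: (N.modulo _ _); lia.
Qed.

(* [s] lists the candidates for [n] modulo [L]; a step [(a, M, Q)] lifts them
   modulo [L * a] and filters them with the condition [(M, Q)]. *)
Fixpoint sieve l d (steps : seq (nat * Z * Z)) (L : N) (s : seq N) : bool :=
  if steps is (a, M, Q) :: steps' then
    let L' := N.mul L (N.of_nat a) in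
    [&& (0 < a)%N, pow10_stable M Q, is_period M L' &
      sieve l d steps' L' [seq i <- lifts L a s | residue_test l d M Q i]]
  else nilp s.

Lemma sieve_sound l d steps L s n m :
  sieve l d steps L s -> (4 <= m)%N -> N.modulo (N.of_nat n) L \in s ->
  9 * Z.of_nat (succ_prod n l) + d <> d * 10 ^ Z.of_nat m.
Proof.
move=> + m4 + E; elim: steps L s => [|[[a M] Q] steps IHs] L s /=.
  by move=> /nilP ->.
case/and4P=> a0 stab per /IHs{}IHs ns; apply: IHs.
by rewrite mem_filter mem_lifts // (residue_testP stab per m4 E).
Qed.

(* 44641 and 4093 are primes modulo which both the period of the Tribonacci
   sequence (44640 and 4092) and the order of 10 (186 and 22) are small and
   smooth; each step keeps the total modulus a multiple of the period. *)
Definition sieve_steps : seq (nat * Z * Z) :=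
  [:: (32%N, 16, 1); (31%N, 5, 1); (5%N, 25, 1); (9%N, 44641, 186);
      (11%N, 4093, 22)].

(** Starting from class 0 modulo 1 puts no restriction on the index; the final modulus is $32 \cdot
    31 \cdot 5 \cdot 9 \cdot 11 = 491040$. *)
Lemma sieve_steps_empty :
  all (fun l => all (fun d =>
    sieve l (Z.of_nat d) sieve_steps 1%num [:: 0%num]) (iota 1 9)) (iota 1 7).
Proof. by vm_compute. Qed.

Local Close Scope Z_scope.

(** * Long products, small cases and the conclusion *)

Lemma repdigit_equation n l m d : succ_prod n l = d * repunit m ->
  (9 * Z.of_nat (succ_prod n l) + Z.of_nat d
    = Z.of_nat d * 10 ^ Z.of_nat m)%Z.
Proof.
move=> E; have := repunitE m; move/(congr1 Z.of_nat).
have -> : Z.of_nat (10 ^ m) = (10 ^ Z.of_nat m)%Z by lia.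
have -> : Z.of_nat (9 * repunit m + 1) = (9 * Z.of_nat (repunit m) + 1)%Z.
  by lia.
by move=> <-; rewrite E Nat2Z.inj_mul; ring.
Qed.

(** Modulo 16 the sequence repeats after 32 terms, which leaves 32 starting indices to evaluate. *)
Lemma dvd16_succ_prod8 n : 16 %| succ_prod n 8.
Proof.
have := succ_prod_mod n 8 (isT : is_period 16 32).
rewrite -[X in N_state _ X]N2Nat.id N_to_nat_mod.
have lt32 : n %% N.to_nat 32 \in iota 0 32 by rewrite mem_iota ltn_pmod.
have /allP/(_ _ lt32)/Z.eqb_eq : all (fun i =>
  (state_prod (N_state 16 (N.of_nat i)) 8 mod 16 =? 0)%Z) (iota 0 32).
  by vm_compute.
rewrite /eqm => -> Hmod.
have := Z_div_mod_eq_full (Z.of_nat (succ_prod n 8)) 16; rewrite -Hmod.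
by move: (succ_prod n 8) (_ / _)%Z => k q; lia.
Qed.

(** The repunit is coprime to 16, so 16 would have to divide the digit [d]. *)
Lemma long_prod_not_repdigit n l m d : 0 < m -> 0 < d <= 9 -> 8 <= l ->
  succ_prod n l <> d * repunit m.
Proof.
move=> m0 d19 l8 E; suff : 16 %| d by move/dvdn_leq; lia.
rewrite -(Gauss_dvdl _ (coprime_repunit_16 m0)) -E -(subnKC l8) succ_prodD.
by rewrite dvdn_mulr // dvd16_succ_prod8.
Qed.

(** A finite check: the two sides of the equation already differ modulo 1000 in every case, which
    avoids computing the products in unary. *)
Lemma small_prod_not_repdigit n l m d : n <= 13 -> 0 < l <= 7 -> 2 <= m <= 3 ->
  0 < d <= 9 -> succ_prod n l <> d * repunit m.
Proof.
move=> n13 l17 m23 d19 /repdigit_equation.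
have /(@state_prodP _ _ _ l) := N_stateP 1000 (N.of_nat n).
rewrite Nat2N.id => Hmod E.
have in_iota i a k : a <= i -> i < a + k -> i \in iota a k.
  by rewrite mem_iota => -> ->.
have : all (fun n => all (fun l => all (fun m => all (fun d =>
    ~~ ((9 * state_prod (N_state 1000 (N.of_nat n)) l + Z.of_nat d) mod 1000
      =? (Z.of_nat d * 10 ^ Z.of_nat m) mod 1000)%Z)
  (iota 1 9)) (iota 2 2)) (iota 1 7)) (iota 0 14) by vm_compute.
have [[l1 l7] [m2 m3] [d1 d9]] := And3 (andP l17) (andP m23) (andP d19).
move=> /allP/(_ n (in_iota _ 0 14 isT n13)) /allP/(_ l (in_iota _ 1 7 l1 l7)).
move=> /allP/(_ m (in_iota _ 2 2 m2 m3)) /allP/(_ d (in_iota _ 1 9 d1 d9)).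
case/negP; apply/Z.eqb_eq; rewrite -E.
by apply: Zplus_eqm => //; apply: Zmult_eqm.
Qed.

Theorem theorem1 (n l m d : nat) :
  0 < n -> 0 < l -> 2 <= m -> 1 <= d <= 9 ->
  \prod_(0 <= i < l) (tribonacci (n + i) + 1) <> d * ((10 ^ m - 1) %/ 9).
Proof.
move=> _ l0 m2 d19; rewrite -/(succ_prod n l) -/(repunit m).
have [l8|l7] := leqP 8 l; first by apply: long_prod_not_repdigit => //; lia.
have [m4|m3] := leqP 4 m => E.
  have := repdigit_equation E.
  apply: (@sieve_sound _ _ sieve_steps 1%num [:: 0%num]) => //.
    have /allP/(_ l) := sieve_steps_empty; rewrite mem_iota l0 => /(_ l7).
    by move/allP/(_ d); apply; rewrite mem_iota.
  by rewrite N.mod_1_r.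
have [n13|n14] := leqP n 13.
  by apply: small_prod_not_repdigit E => //; lia.
(* $T_{14} = 1705$ is the first term above 999, the largest repdigit of at most three digits. *)
have /(leq_trans _) big : tribonacci 14 <= tribonacci n.
  exact: tribonacci_homo.
have : tribonacci n + 1 <= succ_prod n l.
  by rewrite -(prednK l0) succ_prodS leq_pmulr // succ_prod_gt0.
have : 10 ^ m <= 10 ^ 3 by rewrite leq_exp2l.
have := repunitE m.
have := big 1000 isT.
by rewrite E (_ : 10 ^ 3 = 1000) //; move: (10 ^ m) (repunit m) => x r; nia.
Qed.
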